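(* Consider $X=Y$. There is a key-agreement scheme that uses only one-way communication achieving the error-length pair $(0,\, H(X)-2)$.
   Context: Logarithms are base 2 and entropy is in bits. For $K\in\{0,1\}^*$ (finite bit sequences of any length), $|K|$ denotes its length, $K_n$ its $n$-th entry and $K^{n}=(K_1,\dots,K_n)$. A random $K\in\{0,1\}^*$ is a randomly-stopped bit sequence if $\mathbb{P}(K_n=k_n \mid |K|\ge n, K^{n-1}=k^{n-1})=1/2$ for all $n\ge 1$ and $k^n\in\{0,1\}^n$ with $\mathbb{P}(|K|\ge n, K^{n-1}=k^{n-1})>0$. $K$ is a conditionally randomly-stopped bit sequence given $W$ if $p_{K|W=w}$ is a randomly-stopped bit sequence distribution for every $w$ in the support of $W$. Key-agreement setting: $X,Y$ are correlated discrete random variables; Alice observes $X$, Bob observes $Y$; $G_A,G_B$ are local randomness with $(X,Y),G_A,G_B$ mutually independent. They alternate public messages $W_1$ (Alice, from $X,G_A$), $W_2$ (Bob, from $Y,G_B,W_1$), $W_3,\dots$ until stopping at time $N$; the scheme uses only one-way communication if $N=1$ always. Alice outputs $K_A$ (function of $X,G_A,W^N$), Bob outputs $K_B$ (function of $Y,G_B,W^N$). The scheme achieves the error-length pair $(\epsilon,\ell)$ if there exists a random $K\in\{0,1\}^*$ jointly distributed with all these variables such that: $K$ is a conditionally randomly-stopped bit sequence given $W^N$; $\mathbb{P}(K_A=K_B=K)\ge 1-\epsilon$; and $\mathbb{E}[|K|\cdot\mathbf{1}\{K_A=K_B=K\}]\ge \ell$. *)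

(* Defs.v *)
From HB Require Import structures.
From mathcomp Require Import all_boot all_order all_algebra.
From mathcomp Require Import all_classical all_reals.
From mathcomp Require Import ereal esum exp.
Set Implicit Arguments. Unset Strict Implicit. Unset Printing Implicit Defensive.
Import Order.TTheory GRing.Theory Num.Theory.
Local Open Scope classical_set_scope.
Local Open Scope ring_scope.

Section Defs.
Variable R : realType.

Definition is_pmf (T : countType) (p : T -> R) : Prop :=
  (forall t, 0 <= p t) /\ (\esum_(t in setT) (p t)%:E = 1%E).

(* probability of an event (p is a pmf, so the sum is finite) *)
Definition Pr (T : countType) (p : T -> R) (A : set T) : R :=
  fine (\esum_(t in A) (p t)%:E).

Definition log2 (x : R) : R := ln x / ln 2.

(* Shannon entropy in bits (convention 0 log 0 = 0; may be +oo) *)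
Definition entropy (T : countType) (p : T -> R) : \bar R :=
  \esum_(t in setT) (- (p t * log2 (p t)))%:E.

(* q (a pmf on finite bit sequences) is a randomly-stopped bit sequence
   distribution: for n >= 1, k of length n with
   P(|K| >= n, K^{n-1} = k^{n-1}) > 0, P(K_n = k_n | ...) = 1/2.
   K_n (1-indexed) is nth false K (n-1). *)
Definition randomly_stopped (q : seq bool -> R) : Prop :=
  forall (n : nat) (k : seq bool), (0 < n)%N -> size k = n ->
    let E := [set s : seq bool | (n <= size s)%N /\ take n.-1 s = take n.-1 k] in
    0 < Pr q E ->
    Pr q (E `&` [set s | nth false s n.-1 = nth false k n.-1]) / Pr q E = 1 / 2.

Definition cond_randomly_stopped (Om : countType) (p : Om -> R)
    (W_t : countType) (W : Om -> W_t) (K : Om -> seq bool) : Prop :=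
  forall w, 0 < Pr p [set om | W om = w] ->
    randomly_stopped (fun s => Pr p [set om | K om = s /\ W om = w]
                               / Pr p [set om | W om = w]).

(* There is a key-agreement scheme using only one-way communication
   (N = 1: one public message W1 = fW(X, G_A) from Alice) for the source with
   joint pmf pXY that achieves the error-length pair (eps, ell).
   The probability space Om, the local randomness alphabets, the message
   alphabet, and the extra variable K are all existentially chosen. *)
Definition one_way_achieves (X_t Y_t : countType) (pXY : X_t * Y_t -> R)
    (eps : R) (ell : \bar R) : Prop :=
  exists (Om : countType) (p : Om -> R) (GA_t GB_t W_t : countType)
         (XY : Om -> X_t * Y_t) (GA : Om -> GA_t) (GB : Om -> GB_t)
         (fW : X_t -> GA_t -> W_t)
         (fA : X_t -> GA_t -> W_t -> seq bool)
         (fB : Y_t -> GB_t -> W_t -> seq bool)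
         (K : Om -> seq bool),
    let W1 := fun om => fW (XY om).1 (GA om) in
    let KA := fun om => fA (XY om).1 (GA om) (W1 om) in
    let KB := fun om => fB (XY om).2 (GB om) (W1 om) in
    let good := fun om => (KA om == KB om) && (KB om == K om) in
    is_pmf p /\
        (forall xy, Pr p [set om | XY om = xy] = pXY xy) /\
        (forall xy a b,
           Pr p [set om | XY om = xy /\ GA om = a /\ GB om = b]
           = Pr p [set om | XY om = xy] * Pr p [set om | GA om = a]
             * Pr p [set om | GB om = b]) /\
        cond_randomly_stopped p W1 K /\
        1 - eps <= Pr p [set om | good om] /\
        (ell <= \esum_(om in setT)
                  ((size (K om))%:R * (if good om then 1 else 0) * p om)%:E)%E.

Definition diag_pmf (T : countType) (pX : T -> R) (xy : T * T) : R :=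
  if xy.1 == xy.2 then pX xy.1 else 0.

End Defs.

(* Main.v *)
Require Import Defs.
From HB Require Import structures.
From mathcomp Require Import all_boot all_order all_algebra.
From mathcomp Require Import all_classical all_reals.
From mathcomp Require Import ereal esum exp.
From mathcomp Require Import ring lra zify.
Import Order.TTheory GRing.Theory Num.Theory.
Local Open Scope ring_scope.
Local Open Scope classical_set_scope.
Set Implicit Arguments. Unset Strict Implicit.

(** Peel p off in blocks of mass 1/2, 1/4, 1/8, ...  If the remainder r_n has
    mass 2^-n, rounding every r_n(x) down to a power of two keeps at least half
    of it, and taking the rounded masses in decreasing order, the partial sums
    hit 2^-(n+1) exactly; block n is thus 2^-(n+1) times a dyadic distribution,
    i.e. the leaf distribution of a complete prefix code.  Alice announces the
    block W, and the key is the codeword K of X in block W: given W, its bits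
    are fair until it stops.  Since 2^-(W+1) 2^-|K| <= p(X), pointwise
    |K| + (W + 1) >= log 1/p(X), and E[W + 1] = 2.

    Alice must draw W given X = x from a single discrete variable G independent
    of X.  A selected x loses at least half of r_n(x), so the conditional law of
    W given x has, up to order, geometrically decaying atoms, uniformly in x; a
    variable G whose tail decays only like 2/(i+2) can then be distributed
    greedily, atom by atom, so as to realise all these laws simultaneously. *)

(** * Unordered sums and probabilities *)

Lemma esum_le_seq (R : realType) (T : choiceType) (S : set T) (a : T -> R)
    (c : R) :
  (forall s, uniq s -> (forall x, x \in s -> S x) -> \sum_(x <- s) a x <= c) ->
  (\esum_(x in S) (a x)%:E <= c%:E)%E.
Proof.
move=> h; apply: ge_ereal_sup => _ [A [finA AS]] <-.
rewrite fsbig_finite//= sumEFin lee_fin h //.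
by move=> x; rewrite in_fset_set// inE => /AS.
Qed.

Lemma seq_le_esum (R : realType) (T : choiceType) (S : set T) (a : T -> R) s :
  uniq s -> (forall x, x \in s -> S x) ->
  ((\sum_(x <- s) a x)%:E <= \esum_(x in S) (a x)%:E)%E.
Proof.
move=> us sS; apply: esum_ge; exists [set` s].
  by split => //; exact: finite_seq.
by rewrite -fsbig_seq// sumEFin.
Qed.

Lemma esumZ (R : realType) (T : choiceType) (S : set T) (a : T -> \bar R)
    (c : R) : (0 <= c)%R -> (forall x, (0 <= a x)%E) ->
  (\esum_(x in S) (c%:E * a x) = c%:E * \esum_(x in S) a x)%E.
Proof.
(* One inequality for positive factors suffices: the converse is the same inequality with factor
   [c^-1]. *)
have le k (b : T -> \bar R) : (0 < k)%R -> (forall x, (0 <= b x)%E) ->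
    (\esum_(x in S) (k%:E * b x) <= k%:E * \esum_(x in S) b x)%E.
  move=> k0 b0; apply: ge_ereal_sup => _ [A [finA AS]] <-.
  rewrite fsbig_finite//= -ge0_sume_distrr// lee_wpmul2l ?lee_fin ?(ltW k0)//.
  by apply: esum_ge; exists A => //; rewrite fsbig_finite.
move=> c0 a0; move: c0; rewrite le_eqVlt => /orP[/eqP <-|c0].
  by rewrite mul0e esum1// => x _; rewrite mul0e.
apply/le_anti/andP; split; first exact: le.
have ci : (0 < c^-1)%R by rewrite invr_gt0.
have := le _ (fun x => c%:E * a x)%E ci.
rewrite (_ : \esum_(x in S) (c^-1%:E * (c%:E * a x)) = \esum_(x in S) a x)%E; last first.
  by apply: eq_esum => x _; rewrite muleA -EFinM mulVf ?gt_eqF// mul1e.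
have ce : (0 <= c%:E)%E by rewrite lee_fin ltW.
move=> /(_ (fun x => mule_ge0 ce (a0 x))) /(lee_wpmul2l ce).
by rewrite muleA -EFinM mulfV ?gt_eqF// mul1e.
Qed.

Lemma esum_fin_num (R : realType) (T : choiceType) (S : set T) (a : T -> R) c :
  (forall x, 0 <= a x) -> (\esum_(x in [set: T]) (a x)%:E = c%:E)%E ->
  (\esum_(x in S) (a x)%:E)%E \is a fin_num.
Proof.
move=> a0 ac; rewrite ge0_fin_numE; last first.
  by apply: esum_ge0 => x _; rewrite lee_fin.
apply: (@le_lt_trans _ _ c%:E); last exact: ltry.
rewrite -ac esum_mkcond; apply: le_esum => x _.
by case: ifP; rewrite lee_fin.
Qed.

Lemma PrK (R : realType) (T : countType) (p : T -> R) (S : set T) c :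
  (forall x, 0 <= p x) -> (\esum_(x in [set: T]) (p x)%:E = c%:E)%E ->
  ((Pr p S)%:E = \esum_(x in S) (p x)%:E)%E.
Proof. by move=> p0 pc; rewrite /Pr fineK// (esum_fin_num _ p0 pc). Qed.

(** * Prefix codes and randomly stopped sequences *)

Lemma prefix_rcons_cat (b c : bool) (k t : seq bool) :
  prefix (rcons k b) (k ++ c :: t) = (b == c).
Proof. by elim: k => [|a k IH] /=; rewrite ?prefix0s ?andbT// eqxx. Qed.

Lemma prefix_rcons_bool (k s : seq bool) : prefix k s -> s != k ->
  prefix (rcons k true) s = ~~ prefix (rcons k false) s.
Proof.
move=> /prefixP[[|b t] ->]; first by rewrite cats0 eqxx.
by rewrite !prefix_rcons_cat; case: b.
Qed.

(** Induction on [d], the depth allowed below [k]: if [k] is in [L], prefix-freeness leaves nothing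
    else; otherwise every word continues into one of the two children of [k], each worth half of
    [2 ^- size k]. *)
Lemma kraft_seq (R : realType) (d : nat) (k : seq bool) (L : seq (seq bool)) :
  uniq L -> {in L, forall s, prefix k s} ->
  {in L &, forall s t, prefix s t -> s = t} ->
  {in L, forall s, (size s <= size k + d)%N} ->
  \sum_(s <- L) 2 ^- size s <= 2 ^- size k :> R.
Proof.
elim: d k L => [|d IH] k L uL kL pf sz.
all: have [kinL|kNL] := boolP (k \in L).
1,3: rewrite (bigD1_seq k)//= big_seq_cond big1 ?addr0// => s /andP[sL].
1,2: by rewrite (pf k s kinL sL (kL _ sL)) eqxx.
- rewrite big_seq big1 ?invr_ge0 ?exprn_ge0// => s sL; exfalso.
  move/negP: kNL; apply; have /prefixP[t st] := kL _ sL.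
  move: sL (sz _ sL); rewrite st size_cat.
  by case: t {st} => [|b t] /=; rewrite ?cats0//; lia.
- have Lk s : s \in L -> s != k by move=> sL; apply: contraNneq kNL => <-.
  rewrite (bigID (prefix (rcons k false)))/=.
  rewrite [X in _ + X]big_seq_cond.
  rewrite [X in _ + X](eq_bigl (fun s => (s \in L) && prefix (rcons k true) s)); last first.
    move=> s; case: (boolP (s \in L)) => //= sL.
    by rewrite prefix_rcons_bool ?kL ?Lk.
  rewrite -big_seq_cond -[X in X + _]big_filter -[X in _ + X]big_filter.
  have split2 : 2 ^- size k = 2 ^- size (rcons k false) + 2 ^- size (rcons k true) :> R.
    by rewrite !size_rcons exprS; field; rewrite expf_neq0.
  rewrite split2; apply: lerD; apply: IH.
  all: try by rewrite filter_uniq.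
  all: try by move=> s; rewrite mem_filter => /andP[].
  all: try by move=> s t; rewrite !mem_filter => /andP[_ ?] /andP[_ ?]; exact: pf.
  all: by move=> s; rewrite mem_filter size_rcons addSnnS => /andP[_ /sz].
Qed.

Section PrefixCode.
Variables (R : realType) (C : set (seq bool)).
Hypothesis C_prefix : forall s t, C s -> C t -> prefix s t -> s = t.

Let below (k : seq bool) := C `&` [set s | prefix k s].

Lemma kraft k : (\esum_(s in below k) (2 ^- size s)%:E <= (2 ^- size k : R)%:E)%E.
Proof.
apply: esum_le_seq => L uL LC.
apply: (@kraft_seq _ (\max_(s <- L) size s)) => // s.
- by move=> /LC[].
- by move=> t /LC[? _] /LC[? _]; exact: C_prefix.
- by move=> sL; rewrite (leq_trans _ (leq_addl _ _))// leq_bigmax_seq.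
Qed.

Lemma below_split k : ~ C k ->
  (\esum_(s in below k) (2 ^- size s : R)%:E =
   \esum_(s in below (rcons k false)) (2 ^- size s : R)%:E +
   \esum_(s in below (rcons k true)) (2 ^- size s : R)%:E)%E.
Proof.
move=> kC; rewrite (esumID [set s | prefix (rcons k false) s]); last first.
  by move=> s _; rewrite lee_fin invr_ge0 exprn_ge0.
have rk b s : prefix (rcons k b) s -> prefix k s.
  by apply: prefix_trans; exact: prefix_rcons.
congr (_ + _)%E; congr esum; apply/seteqP; split => s /=.
- by move=> [[]].
- by move=> [Cs ps]; split => //; split => //=; exact: rk ps.
- move=> [[Cs ps] /negP]; rewrite -prefix_rcons_bool//.
  by apply: contra_not_neq kC => <-.
- move=> [Cs ps]; split; first by split => //=; exact: rk ps.
  apply/negP; rewrite -prefix_rcons_bool//; first exact: rk ps.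
  by apply: contra_not_neq kC => <-.
Qed.

Hypothesis C_complete : (\esum_(s in C) (2 ^- size s : R)%:E = 1)%E.

(** Going down from the root, Kraft's inequality caps each child at half of its parent's bound, so a
    parent that attains its bound forces both children to attain theirs. *)
Lemma below_complete k : (forall s, C s -> prefix s k -> s = k) ->
  (\esum_(s in below k) (2 ^- size s : R)%:E = (2 ^- size k)%:E)%E.
Proof.
elim/last_ind: k => [|k b IH] kC.
  rewrite expr0 invr1 -C_complete (_ : below [::] = C)//.
  by apply/seteqP; split => s; [case | move=> Cs; split; rewrite //= prefix0s].
have kNC : ~ C k.
  move=> Ck; have := congr1 size (kC _ Ck (prefix_rcons _ _)).
  by rewrite size_rcons; lia.
have kC' s : C s -> prefix s k -> s = k.
  move=> Cs sk; exfalso.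
  have := size_prefix sk. have := kC _ Cs (prefix_trans sk (prefix_rcons _ _)).
  by move=> ->; rewrite size_rcons ltnn.
have := IH kC'; rewrite below_split//.
have := kraft (rcons k false); have := kraft (rcons k true).
have : (0 <= \esum_(s in below (rcons k true)) (2 ^- size s : R)%:E)%E.
  by apply: esum_ge0 => s _; rewrite lee_fin invr_ge0 exprn_ge0.
have : (0 <= \esum_(s in below (rcons k false)) (2 ^- size s : R)%:E)%E.
  by apply: esum_ge0 => s _; rewrite lee_fin invr_ge0 exprn_ge0.
rewrite !size_rcons.
have -> : 2 ^- size k = 2 * 2 ^- (size k).+1 :> R.
  by rewrite exprS; field; rewrite expf_neq0.
case: b {kC}.
all: case: (esum (below (rcons k true)) _) => [x| |] //.
all: case: (esum _ _) => [y| |] //.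
all: rewrite -EFinD !lee_fin => ? ? ? ? [?]; congr EFin; lra.
Qed.

(** Both events amount to lying below a node of the code tree: [take n.-1 k] for the condition, of
    mass 2^-(n-1), and [k] for the joint event, of mass 2^-n. *)
Lemma prefix_code_randomly_stopped (q : seq bool -> R) :
  (forall s, C s -> q s = 2 ^- size s) -> (forall s, ~ C s -> q s = 0) ->
  randomly_stopped q.
Proof.
move=> qC qN n k n0 kn E.
have PrE (A : set (seq bool)) : Pr q A = fine (\esum_(s in C `&` A) (2 ^- size s)%:E)%E.
  rewrite /Pr esum_mkcondl; congr fine; apply: eq_esum => s _.
  by case: ifPn => [/set_mem /qC ->//|/negP h]; rewrite qN// => /mem_set.
have k'n : size (take n.-1 k) = n.-1 by rewrite size_takel// kn leq_pred.
move=> Epos.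
have [s Cs Es] : exists2 s, C s & E s.
  apply: contrapT => h; move: Epos; rewrite PrE esum1 ?ltxx// => s [Cs Es].
  by exfalso; apply: h; exists s.
(* The codeword [s] is strictly longer than [take n.-1 k] and extends it, so a codeword that is a
   prefix of [take n.-1 k] would be a proper prefix of [s]. *)
have k'C t : C t -> prefix t (take n.-1 k) -> False.
  move=> Ct pt; case: Es => ns sk.
  have ts : prefix t s.
    by rewrite (prefix_trans pt)// -sk -{2}(cat_take_drop n.-1 s) prefix_prefix.
  have := C_prefix Ct Cs ts => e; have := size_prefix pt.
  by rewrite e k'n => /(leq_trans ns); rewrite leqNgt ltn_predL n0.
have k'k : k = rcons (take n.-1 k) (nth false k n.-1).
  by rewrite -take_nth ?prednK ?kn// -kn take_size.
rewrite !PrE.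
have -> : C `&` E = below (take n.-1 k).
  apply/seteqP; split => t [Ct] /=.
    by move=> [_ <-]; split => //=; rewrite prefixE size_take_min; apply/eqP;
      rewrite take_min take_size.
  move=> pt; split => //; split; last first.
    by move: pt; rewrite prefixE k'n => /eqP.
  rewrite leqNgt; apply/negP => tn; apply: (k'C _ Ct).
  suff -> : t = take n.-1 k by rewrite prefix_refl.
  move: pt; rewrite prefixE k'n => /eqP <-; rewrite take_oversize//.
  by rewrite -ltnS prednK.
have -> : C `&` (E `&` [set t | nth false t n.-1 = nth false k n.-1]) = below k.
  apply/seteqP; split => t [Ct] /=.
    move=> [[nt tk] nk]; split => //=.
    rewrite {1}k'k -tk -nk -take_nth ?prednK//.
    by rewrite -{2}(cat_take_drop n t) prefix_prefix.
  move=> /prefixP[u tE]; split; rewrite // tE /E /= size_cat kn leq_addr.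
  by rewrite takel_cat ?kn ?leq_pred// nth_cat kn ltn_predL n0.
rewrite !below_complete//=.
- rewrite k'n kn -{1}(prednK n0) exprS; field; rewrite expf_neq0//.
- by move=> t Ct /(k'C _ Ct).
(* A codeword that is a prefix of [k] but not [k] itself would be a prefix of [take n.-1 k], which
   [k'C] excludes. *)
- move=> t Ct; rewrite {1}k'k => pt; apply: contrapT => tk.
  apply: (k'C _ Ct); move: pt; rewrite !prefixE => /eqP pt.
  case: (ltnP (size t) n) => st.
    apply/eqP; rewrite -{2}pt -k'k -take_min; congr take.
    by apply/minn_idPl; rewrite -ltnS prednK.
  exfalso; apply: tk; rewrite -pt -k'k take_oversize ?kn//.
Qed.

End PrefixCode.

(** * Simulation from one discrete variable *)

Lemma ler_sum_sub_uniq (R : numDomainType) (T : eqType) (s s' : seq T)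
    (a : T -> R) :
  uniq s -> uniq s' -> {subset s <= s'} -> (forall x, 0 <= a x) ->
  \sum_(x <- s) a x <= \sum_(x <- s') a x.
Proof.
move=> us us' ss' a0; rewrite [leRHS](bigID (mem s))/= -[leLHS]addr0 lerD//.
  rewrite -[leRHS]big_filter (perm_big [seq x <- s' | x \in s])//.
  apply: uniq_perm => //; first by rewrite filter_uniq.
  by move=> x; rewrite mem_filter; case: (boolP (x \in s)) => // /ss' ->.
exact: sumr_ge0.
Qed.

(** The atoms telescope: [harmonic_tail i] is the mass of all atoms from [i] on, and
    [harmonic_tail 0] is 1. *)
Definition harmonic_atom {R : realType} (i : nat) : R := 2 / (i.+2 * i.+3)%:R.
Definition harmonic_tail {R : realType} (i : nat) : R := 2 / i.+2%:R.

Section Allocation.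
Variable R : realType.
Local Notation atom := (@harmonic_atom R).
Local Notation tail := (@harmonic_tail R).

Lemma atom_gt0 i : 0 < atom i.
Proof. by rewrite divr_gt0// ltr0n. Qed.

Lemma tailS i : tail i = atom i + tail i.+1.
Proof.
rewrite /harmonic_tail /harmonic_atom natrM.
have x0 : i.+2%:R != 0 :> R by rewrite pnatr_eq0.
have y0 : i.+3%:R != 0 :> R by rewrite pnatr_eq0.
have e : i.+3%:R = i.+2%:R + 1 :> R by rewrite natr1.
move: x0 y0 e; move: (i.+2%:R : R) (i.+3%:R : R) => x y x0 y0 ey.
by rewrite ey; field; rewrite -ey y0 x0.
Qed.

Lemma tail_lt (e : R) : 0 < e -> exists i, tail i <= e.
Proof.
move=> e0; exists (Num.truncn (2 / e)); rewrite ler_pdivrMr ?ltr0n//.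
rewrite mulrC -ler_pdivrMr//; apply/ltW/(lt_trans (truncnS_gt _)).
by rewrite ltr_nat.
Qed.

Lemma sum_atom n : \sum_(i < n) atom i = 1 - tail n.
Proof.
elim: n => [|n IH]; first by rewrite big_ord0 /harmonic_tail divff ?subrr.
by rewrite big_ord_recr /= IH [tail n]tailS; lra.
Qed.

(** Equivalently, [tail i - i.+1%:R * atom i], which is 4 / ((i+2)(i+3)), exceeds 2^-(i+1). *)
Lemma quadratic_lt_exp i : (i.+2 * i.+3 < 4 * 2 ^ i.+1)%N.
Proof. by elim: i => // i IH; rewrite expnS; nia. Qed.

(** In the application [r n] is the fraction of p(x) that remains before block [n], and [d n], the
    capacity of bin [n], is the conditional probability of that block given x. *)
Variable r : nat -> R.
Hypothesis r0 : r 0%N = 1.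
Hypothesis r_ge0 : forall n, 0 <= r n.
Hypothesis r_cvg0 : forall e, 0 < e -> exists n, r n <= e.
Hypothesis r_dec : forall n, r n.+1 <= r n.
Hypothesis r_half : forall n, r n.+1 != r n -> 2 * r n.+1 <= r n.

Let d n := r n - r n.+1.
Let drops n := (\sum_(j < n) (r j.+1 != r j))%N.

(** Each genuine drop at least halves [r], which starts at 1. *)
Lemma drops_bound n : r n * 2 ^+ drops n <= 1.
Proof.
elim: n => [|n IH]; first by rewrite /drops big_ord0 mulr1 r0.
rewrite /drops big_ord_recr /= -/(drops n).
case: eqP => [->|/eqP/r_half h] /=; first by rewrite addn0.
rewrite addn1 exprS mulrA [_ * 2]mulrC; apply: le_trans IH.
by rewrite ler_wpM2r ?exprn_ge0.
Qed.

(* If no bin could take the i-th atom, the at most i + 1 bins in use before r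
   drops below 2^-(i+1) would hold less than tail i - r; this is where the tail has
   to decay slower than geometrically. *)
Lemma bin_with_room i (c : nat -> R) :
  (forall n, 0 <= c n <= d n) ->
  (forall n, tail i - r n <= \sum_(j < n) c j) ->
  exists n, atom i <= c n.
Proof.
move=> cd cs; apply: contrapT => noroom.
have ca n : c n < atom i by rewrite ltNge; apply/negP => h; apply: noroom; exists n.
have e0 : 0 < 2 ^- i.+1 :> R by rewrite invr_gt0 exprn_gt0.
have ex : exists n, r n <= 2 ^- i.+1 by exact: r_cvg0.
have [m rm mmin] := ex_minnP ex.
(* As [m] is the first index with [r m <= 2 ^- i.+1], [drops_bound] allows at most [i] drops before
   the last step, which may add one more. *)
have dm : (drops m <= i.+1)%N.
  case: m rm mmin => [|m] _ mmin; first by rewrite /drops big_ord0.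
  have : 2 ^- i.+1 < r m by rewrite ltNge; apply/negP => /mmin; rewrite ltnn.
  move=> h; have := drops_bound m; rewrite /drops big_ord_recr /= -/(drops m).
  rewrite leNgt => h2; suff : (drops m < i.+1)%N by case: eqP => _ /=; lia.
  rewrite ltnNge; apply: contra h2 => h2.
  have : 2 ^- i.+1 * 2 ^+ i.+1 < r m * 2 ^+ drops m.
    apply: (@lt_le_trans _ _ (r m * 2 ^+ i.+1)).
      by rewrite ltr_pM2r// exprn_gt0.
    by rewrite ler_wpM2l// ler_eXn2l// ltr1n.
  by rewrite mulVf// expf_neq0.
have : \sum_(j < m) c j <= (drops m)%:R * atom i.
  rewrite /drops natr_sum mulr_suml; apply: ler_sum => j _.
  have /andP[c0 cdj] := cd j.
  case: eqP => [e|_] /=; last by rewrite mul1r ltW.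
  by move: cdj; rewrite /d e subrr mul0r.
move=> h; have {h} := le_trans (cs m) h.
have : (drops m)%:R * atom i <= i.+1%:R * atom i.
  by rewrite ler_wpM2r ?(ltW (atom_gt0 _))// ler_nat.
have q : (i.+2 * i.+3)%:R < 4 * 2 ^+ i.+1 :> R.
  by rewrite -natrX -natrM ltr_nat quadratic_lt_exp.
have q' : 2 ^- i.+1 * (i.+2 * i.+3)%:R < 4 :> R.
  by rewrite mulrC ltr_pdivrMr ?exprn_gt0.
have tE : tail i * (i.+2 * i.+3)%:R = 2 * i.+3%:R.
  by rewrite /harmonic_tail natrM mulrA divfK ?pnatr_eq0.
have aE : atom i * (i.+2 * i.+3)%:R = 2.
  by rewrite /harmonic_atom divfK ?pnatr_eq0 ?muln_eq0.
have P0 : 0 < (i.+2 * i.+3)%:R :> R by rewrite ltr0n.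
move: P0 q' tE aE rm; set P := (i.+2 * i.+3)%:R; set e := 2 ^- _ => P0 q' tE aE rm h1 h2.
have h3 : tail i <= i.+1%:R * atom i + e by lra.
have : tail i * P <= (i.+1%:R * atom i + e) * P by rewrite ler_pM2r.
have -> : (i.+1%:R * atom i + e) * P = i.+1%:R * (atom i * P) + e * P by ring.
rewrite tE aE -[i.+3%:R]natr1 -[i.+2%:R]natr1; lra.
Qed.

(** Greedy placement: an atom goes whole into some bin that can hold it. The default 0 is never
    reached, since [bin_with_room] applies to every [room i]. *)
Let choose_bin i (c : nat -> R) : nat := xget 0%N [set n | atom i <= c n].

Fixpoint room (i : nat) : nat -> R :=
  if i is j.+1 then
    fun n => room j n - (if n == choose_bin j (room j) then atom j else 0)
  else d.

Definition bin i := choose_bin i (room i).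

(** The last two clauses express through partial sums that the total room left is [tail i]: the
    lower bound has error [r n], the full capacity of the bins from [n] on, and the upper bound
    needs [n] to be past every bin used so far. *)
Lemma room_spec i : [/\ forall n, 0 <= room i n <= d n,
  forall n, tail i - r n <= \sum_(j < n) room i j &
  exists m, forall n, (m <= n)%N -> \sum_(j < n) room i j <= tail i].
Proof.
have sumd n : \sum_(j < n) d j = 1 - r n.
  elim: n => [|n IH]; first by rewrite big_ord0 r0 subrr.
  by rewrite big_ord_recr /= IH /d; lra.
elim: i => [|i [rd rs [m rm]]] /=.
  have t0 : tail 0 = 1 by rewrite /harmonic_tail divff.
  split=> [n|n|]; first by rewrite lexx subr_ge0 r_dec.
    by rewrite sumd t0.
  by exists 0%N => n _; rewrite sumd t0 gerBl.
have fit : atom i <= room i (bin i).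
  exact: (xgetPex 0%N (bin_with_room rd rs)).
have a0 := atom_gt0 i; have ts := tailS i.
rewrite -/(bin i); split=> [n|n|].
- have /andP[h1 h2] := rd n; apply/andP.
  by case: eqP => [->|_]; split; rewrite ?subr0// ?subr_ge0//; have /andP[] := rd (bin i); lra.
- rewrite sumrB -big_mkcond /=; have := rs n.
  suff : \sum_(j < n | j == bin i :> nat) atom i <= atom i by lra.
  have [bn|nb] := ltnP (bin i) n; first by rewrite (big_pred1 (Ordinal bn)).
  rewrite big_pred0 ?(ltW a0)// => j; apply/negbTE; have := ltn_ord j; lia.
- exists (maxn m (bin i).+1) => n; rewrite geq_max => /andP[mn bn].
  rewrite sumrB -big_mkcond /= [X in _ - X](big_pred1 (Ordinal bn))//.
  by have := rm _ mn; lra.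
Qed.

Lemma roomE i n : room i n = d n - \sum_(j < i | bin j == n) atom j.
Proof.
elim: i => [|i IH] /=; first by rewrite big_ord0 subr0.
by rewrite [in RHS]big_mkcond big_ord_recr /= -big_mkcond IH -/(bin i) eq_sym;
  case: ifP => _; lra.
Qed.

(** A bin is never overfilled, and after [i] atoms its room is at most the total room [tail i],
    which tends to 0. *)
Lemma bin_mass n : (\esum_(i in [set i | bin i = n]) (atom i)%:E = (d n)%:E)%E.
Proof.
have a0 i := ltW (atom_gt0 i).
apply/le_anti/andP; split.
  apply: esum_le_seq => s us sn.
  have [B sB] : exists B, {subset s <= iota 0 B}.
    exists (\max_(i <- s) i)%N.+1 => i si; rewrite mem_iota /= add0n ltnS.
    exact: (@leq_bigmax_seq _ s xpredT id).
  have [/(_ n)/andP[h _] _ _] := room_spec B; move: h.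
  rewrite roomE subr_ge0; apply: le_trans.
  rewrite -(big_mkord (fun j => bin j == n) atom) /index_iota subn0 -big_filter.
  apply: ler_sum_sub_uniq => //; first by rewrite filter_uniq// iota_uniq.
  by move=> i si; rewrite mem_filter sB// andbT; apply/eqP/sn.
apply/lee_addgt0Pr => e e0; have [i ti] := tail_lt e0.
have [rd _ [m rm]] := room_spec i.
have rt : room i n <= e.
  apply: le_trans ti; apply: le_trans (rm (maxn m n.+1) (leq_maxl _ _)).
  have nm : (n < maxn m n.+1)%N by exact: leq_maxr.
  rewrite (bigD1 (Ordinal nm))//= lerDl sumr_ge0// => j _.
  by have /andP[] := rd j.
move: rt; rewrite roomE => rt.
apply: (@le_trans _ _ ((\sum_(j < i | bin j == n) atom j)%:E + e%:E)%E).
  by rewrite -EFinD lee_fin; lra.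
rewrite leeD2r// -(big_mkord (fun j => bin j == n) atom) -big_filter.
apply: seq_le_esum; first by rewrite filter_uniq// iota_uniq.
by move=> j; rewrite mem_filter => /andP[/eqP].
Qed.

End Allocation.

Lemma esum_harmonic_atom (R : realType) :
  (\esum_(i in [set: nat]) (@harmonic_atom R i)%:E = 1)%E.
Proof.
have a0 i : 0 <= harmonic_atom i :> R by exact/ltW/atom_gt0.
apply/le_anti/andP; split.
  apply: esum_le_seq => s us _.
  have [B sB] : exists B, {subset s <= iota 0 B}.
    exists (\max_(i <- s) i)%N.+1 => i si; rewrite mem_iota /= add0n ltnS.
    exact: (@leq_bigmax_seq _ s xpredT id).
  apply: (@le_trans _ _ (\sum_(i < B) harmonic_atom i)); last first.
    by rewrite sum_atom gerBl divr_ge0.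
  rewrite -(big_mkord xpredT) /index_iota subn0.
  by apply: ler_sum_sub_uniq => //; rewrite iota_uniq.
apply/lee_addgt0Pr => e e0; have [i ti] := tail_lt e0.
apply: (@le_trans _ _ ((\sum_(j < i) harmonic_atom j)%:E + e%:E)%E).
  by rewrite -EFinD lee_fin sum_atom; lra.
rewrite leeD2r// -(big_mkord xpredT).
by apply: seq_le_esum; rewrite // iota_uniq.
Qed.

(** * Dyadic blocks *)

Lemma exp2N_le (R : realType) (e : R) : 0 < e -> exists n, 2 ^- n <= e.
Proof.
move=> e0; exists (Num.truncn e^-1).+1.
rewrite -[leRHS]invrK lef_pV2 ?posrE ?exprn_gt0 ?invr_gt0//.
apply/ltW/(lt_trans (truncnS_gt _)).
by rewrite -natrX ltr_nat ltn_expl.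
Qed.

(** The least [n] with [2 ^- n <= x] works: minimality gives the upper bound, except at [n = 0],
    where it is [x <= 2]. *)
Lemma dyadic_bracket (R : realType) (x : R) : 0 < x -> x <= 2 ->
  exists n, 2 ^- n <= x <= 2 * 2 ^- n.
Proof.
move=> x0 x2; have [n nx nmin] := ex_minnP (exp2N_le x0).
exists n; rewrite nx; case: n nx nmin => [|n] nx nmin; first by rewrite invr1; lra.
rewrite (_ : 2 * 2 ^- n.+1 = 2 ^- n) => [|]; last first.
  by rewrite exprS; field; rewrite expf_neq0.
by rewrite leNgt; apply/negP => /ltW/nmin; rewrite ltnn.
Qed.

(** Most significant bit first, so that the first bits of a word encode a quotient by a power of
    two; only the [l] lowest bits of [N] are kept. *)
Fixpoint bits (l N : nat) : seq bool :=
  if l is l'.+1 then rcons (bits l' N./2) (odd N) else [::].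

Lemma size_bits l N : size (bits l N) = l.
Proof. by elim: l N => //= l IH N; rewrite size_rcons IH. Qed.

Lemma bits_inj l N M : (N < 2 ^ l)%N -> (M < 2 ^ l)%N ->
  bits l N = bits l M -> N = M.
Proof.
elim: l N M => [|l IH] N M; first by rewrite expn0 !ltnS !leqn0 => /eqP -> /eqP ->.
rewrite expnS => NN MM /= /rcons_inj[/IH h o].
by rewrite -[N]odd_double_half -[M]odd_double_half o h//; lia.
Qed.

Lemma take_bits l e N : take l (bits (l + e) N) = bits l (N %/ 2 ^ e).
Proof.
elim: e N => [|e IH] N; first by rewrite addn0 divn1 -{1}(size_bits l N) take_size.
rewrite addnS /= -cats1 takel_cat ?size_bits ?leq_addr// IH.
by rewrite -divn2 -divnMA expnS.
Qed.

Lemma prefix_bits l e N M : (N < 2 ^ l)%N -> (M < 2 ^ (l + e))%N ->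
  prefix (bits l N) (bits (l + e) M) -> N = (M %/ 2 ^ e)%N.
Proof.
move=> Nl Ml; rewrite prefixE size_bits take_bits => /eqP/esym; apply: bits_inj => //.
by rewrite ltn_divLR ?expn_gt0// -expnD.
Qed.

(** * Prefix codes from sorted dyadic masses *)

Section SortedCode.
Variables (R : realType) (T : countType) (D : set T) (l : T -> nat) (L : nat -> seq T).
Hypothesis uniq_L : forall m, uniq (L m).
Hypothesis mem_L : forall m x, x \in L m <-> D x /\ (l x <= m)%N.

(** Decreasing mass [2 ^- l], ties broken by [pickle]; the items of [D] that precede [x] all lie in
    the finite list [L (l x)]. *)
Let before y x := (l y < l x)%N || (l y == l x) && (pickle y < pickle x)%N.

Let total x y : [\/ x = y, before x y | before y x].
Proof.
rewrite /before; case: (ltngtP (l x) (l y)) => h /=; first by apply: Or32.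
  by apply: Or33.
case: (ltngtP (pickle x) (pickle y)) => h' /=; first by apply: Or32.
  by apply: Or33.
by apply: Or31; apply: (pcan_inj (@pickleK T)).
Qed.

Let before_le y x : before y x -> (l y <= l x)%N.
Proof. by case/orP => [/ltnW//|/andP[/eqP->]]. Qed.

Let before_trans x y z : before x y -> before y z -> before x z.
Proof. by rewrite /before; lia. Qed.

Let before_irr x : before x x = false.
Proof. by rewrite /before !ltnn andbF. Qed.

(* N x / 2 ^ l x is the total mass of the items preceding x, so the word of x is
   the binary expansion of that partial sum. *)
Let N x := (\sum_(y <- L (l x) | before y x) 2 ^ (l x - l y))%N.

(** Whatever precedes [y], and [y] itself, precedes [x]; passing from units of [2 ^- l y] to units
    of [2 ^- l x] multiplies by [2 ^ (l x - l y)]. *)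
Lemma sorted_code_step x y : D x -> D y -> before y x ->
  ((N y).+1 * 2 ^ (l x - l y) <= N x)%N.
Proof.
move=> Dx Dy yx; have lyx := before_le yx.
have yL : y \in L (l x) by apply/mem_L.
rewrite [leqRHS]/N [leqRHS]big_mkcond (bigD1_seq y)//= yx mulSn leq_add2l /N big_distrl /=.
have -> : (\sum_(z <- L (l y) | before z y) 2 ^ (l y - l z) * 2 ^ (l x - l y) =
   \sum_(z <- L (l x) | before z y) 2 ^ (l x - l z))%N.
  rewrite -big_filter -[RHS]big_filter.
  have p : perm_eq [seq z <- L (l y) | before z y] [seq z <- L (l x) | before z y].
    apply: uniq_perm; rewrite ?filter_uniq// => z; rewrite !mem_filter.
    case zy : (before z y) => //=; have lzy := before_le zy.
    apply/idP/idP => /mem_L [Dz lz]; apply/mem_L; split => //.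
    exact: leq_trans lyx.
  rewrite (perm_big _ p) /= big_seq [RHS]big_seq; apply: eq_bigr => z.
  rewrite mem_filter => /andP[/before_le zy _]; rewrite -expnD; congr (2 ^ _)%N; lia.
rewrite big_mkcond [leqRHS]big_mkcond; apply: leq_sum => z _.
case: ifP => // zy; rewrite (before_trans zy yx).
by case: eqP => // e; move: zy; rewrite e before_irr.
Qed.

(** Membership means that the partial sum before [x] is below 1, so that [l x] bits hold [N x]
    without truncation. *)
Let sel : set T := [set x | D x /\ (N x < 2 ^ l x)%N].
Let word x := bits (l x) (N x).

(** A prefix would put the partial sum of [y] inside the dyadic interval of length [2 ^- l x]
    starting at that of [x]; for distinct items [sorted_code_step] rules this out in either
    order. *)
Lemma sorted_code_prefix x y : sel x -> sel y -> prefix (word x) (word y) -> x = y.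
Proof.
move=> [Dx Nx] [Dy Ny] pxy.
have lxy : (l x <= l y)%N by have := size_prefix pxy; rewrite !size_bits.
have Nxy : N x = (N y %/ 2 ^ (l y - l x))%N.
  by apply: (@prefix_bits (l x)); rewrite ?subnKC.
case: (total x y) => // xy.
  have := sorted_code_step Dy Dx xy.
  by rewrite -leq_divRL ?expn_gt0// -Nxy ltnn.
have lyx : l y = l x by apply/eqP; rewrite eqn_leq lxy before_le.
have := sorted_code_step Dx Dy xy.
by rewrite lyx subnn expn0 muln1 Nxy lyx subnn expn0 divn1 ltnn.
Qed.

(** Kraft's inequality gives the upper bound. For the lower one, either all of [D] is selected, or
    the items before the first unselected one are all selected and already have mass at least 1. *)
Lemma sorted_code_complete :
  (1 <= \esum_(x in D) (2 ^- l x : R)%:E)%E ->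
  (\esum_(x in sel) (2 ^- l x : R)%:E = 1)%E.
Proof.
move=> D1; apply/le_anti/andP; split.
  rewrite (eq_esum (b := fun x => (2 ^- size (word x) : R)%:E)); last first.
    by move=> x _; rewrite size_bits.
  rewrite -(@esum_image R _ _ sel word (fun s => (2 ^- size s : R)%:E)); last first.
    move=> x y /set_mem sx /set_mem sy e; apply: sorted_code_prefix => //.
    by rewrite e prefix_refl.
  have pf s t : (word @` sel) s -> (word @` sel) t -> prefix s t -> s = t.
    by move=> [x sx <-] [y sy <-] /sorted_code_prefix ->.
  have := kraft R pf [::]; rewrite /= expr0 invr1.
  by rewrite (_ : _ `&` _ = word @` sel)//; apply/seteqP; split => s; [case|];
    rewrite //= => h; split; rewrite //= prefix0s.
have [[x Dx xN]|alls] := pselect (exists2 x, D x & ~ sel x); last first.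
  rewrite (_ : sel = D)//; apply/seteqP; split => x; first by case.
  by move=> Dx; apply: contrapT => h; apply: alls; exists x.
have [y [Dy yN ymin]] : exists y, [/\ D y, ~ sel y & forall z, D z -> before z y -> sel z].
  have exl : exists m, `[< exists2 x, D x /\ l x = m & ~ sel x >].
    by exists (l x); apply/asboolP; exists x.
  have [m /asboolP[x1 [Dx1 lx1] x1N] mmin] := ex_minnP exl.
  have exp : exists k, `[< exists x, [/\ D x, l x = m, pickle x = k & ~ sel x] >].
    by exists (pickle x1); apply/asboolP; exists x1.
  have [k /asboolP[y [Dy ly py yN]] kmin] := ex_minnP exp.
  exists y; split => // z Dz zy; apply: contrapT => zN.
  have mz : (m <= l z)%N by apply: mmin; apply/asboolP; exists z.
  move: zy; rewrite /before ly ltnNge mz /= => /andP[/eqP lz].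
  by rewrite py ltnNge kmin//; apply/asboolP; exists z.
have Ny : (2 ^ l y <= N y)%N.
  by rewrite leqNgt; apply/negP => h; apply: yN.
apply: (@le_trans _ _ (\sum_(z <- [seq z <- L (l y) | before z y]) (2 ^- l z : R))%:E).
  rewrite lee_fin big_filter.
  have : (2 ^ l y)%:R <= (N y)%:R :> R by rewrite ler_nat.
  rewrite /N natr_sum -[leLHS]mul1r -ler_pdivlMr ?ltr0n ?expn_gt0//.
  rewrite mulr_suml; move/le_trans; apply.
  rewrite le_eqVlt; apply/orP; left; apply/eqP; apply: eq_bigr => z /before_le zy.
  by rewrite !natrX exprB ?unitfE// mulrAC mulfV ?mul1r// expf_neq0.
apply: seq_le_esum; first by rewrite filter_uniq.
by move=> z; rewrite mem_filter => /andP[zy /mem_L[Dz _]]; exact: ymin.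
Qed.

Lemma sorted_code : (1 <= \esum_(x in D) (2 ^- l x : R)%:E)%E ->
  exists (S : set T) (w : T -> seq bool), [/\ S `<=` D,
    forall x, size (w x) = l x,
    forall x y, S x -> S y -> prefix (w x) (w y) -> x = y &
    (\esum_(x in S) (2 ^- size (w x) : R)%:E = 1)%E].
Proof.
move=> D1; exists sel, word; split.
- by move=> x [].
- by move=> x; rewrite size_bits.
- exact: sorted_code_prefix.
- rewrite -sorted_code_complete//; apply: eq_esum => x _.
  by rewrite size_bits.
Qed.

End SortedCode.

(** Each item of this level has mass at least [2 ^- m], so there are at most [c * 2 ^+ m] of
    them. *)
Lemma finite_dyadic_level (R : realType) (T : countType) (D : set T)
    (l : T -> nat) (c : R) (m : nat) :
  (\esum_(x in D) (2 ^- l x : R)%:E <= c%:E)%E ->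
  finite_set [set x | D x /\ (l x <= m)%N].
Proof.
move=> Dc; apply: contrapT => /infinite_set_fset.
move=> /(_ (Num.truncn (c * 2 ^+ m)).+1)[B BD cB].
have h : \sum_(x <- finmap.enum_fset B) (2 ^- l x : R) <= c.
  rewrite -lee_fin; apply: le_trans Dc; apply: seq_le_esum => //.
  by move=> x xB; have [] := BD x xB.
have : \sum_(x <- finmap.enum_fset B) (2 ^- m : R) <= c.
  apply: le_trans h; rewrite big_seq [leRHS]big_seq; apply: ler_sum => x xB.
  have [_ lm] := BD x xB.
  by rewrite lef_pV2 ?posrE ?exprn_gt0// ler_eXn2l// ltr1n.
rewrite big_const_seq count_predT iter_addr_0 -[_ *+ _]mulr_natl.
rewrite ler_pdivrMr ?exprn_gt0//.
apply/negP; rewrite -ltNge; apply: (lt_le_trans (truncnS_gt _)).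
by rewrite ler_nat.
Qed.

(** [None] marks a source value that the block leaves out. *)
Definition word_weight {R : realType} (o : option (seq bool)) : R :=
  if o is Some s then 2 ^- size s else 0.

(** Rounding down to powers of two keeps at least half of the mass 2, hence at least 1, and
    [sorted_code] picks a part of mass exactly 1. *)
Lemma dyadic_layer (R : realType) (T : countType) (f : T -> R) :
  (forall x, 0 <= f x) -> (\esum_(x in [set: T]) (f x)%:E = 2%:E)%E ->
  exists k : T -> option (seq bool), [/\
    forall x s, k x = Some s -> 2 ^- size s <= f x <= 2 * 2 ^- size s,
    forall x y s t, k x = Some s -> k y = Some t -> prefix s t -> x = y &
    (\esum_(x in [set: T]) (word_weight (k x) : R)%:E = 1)%E].
Proof.
move=> f0 f2; pose D := [set x | 0 < f x].
have fle x : f x <= 2.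
  rewrite -lee_fin -f2 (_ : f x = \sum_(y <- [:: x]) f y); last by rewrite big_seq1.
  by apply: seq_le_esum.
have /choice[l lP] x : exists n, 0 < f x -> 2 ^- n <= f x <= 2 * 2 ^- n.
  have [fx|nfx] := pselect (0 < f x); last by exists 0%N => /nfx.
  by have [n] := dyadic_bracket fx (fle x); exists n.
have fD : (\esum_(x in D) (f x)%:E = 2%:E)%E.
  rewrite -f2 esum_mkcond; apply: eq_esum => x _; case: ifPn => // /negP h.
  congr EFin; apply/le_anti; rewrite f0 /= leNgt; apply/negP => h'; apply: h.
  exact/mem_set.
have D2 : (\esum_(x in D) (2 ^- l x : R)%:E <= 2%:E)%E.
  by rewrite -fD; apply: le_esum => x /lP /andP[h _]; rewrite lee_fin.
have D1 : (1 <= \esum_(x in D) (2 ^- l x : R)%:E)%E.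
  rewrite -(@lee_pmul2l _ 2%:E)//.
  rewrite mule1 -esumZ//.
  by rewrite -[leLHS]fD; apply: le_esum => x /lP /andP[_ h]; rewrite -EFinM lee_fin.
have finL m := finite_dyadic_level m D2.
pose L m := finmap.enum_fset (fset_set [set x | D x /\ (l x <= m)%N]).
have memL m x : x \in L m <-> D x /\ (l x <= m)%N.
  by rewrite /L in_fset_set// inE.
have [S [w [SD sw pw w1]]] := sorted_code (fun m => finmap.fset_uniq _) memL D1.
exists (fun x => if x \in S then Some (w x) else None); split.
- move=> x s; case: ifPn => // /set_mem /SD/lP h [<-].
  by rewrite sw.
- move=> x y s t; case: ifPn => // /set_mem Sx [<-]; case: ifPn => // /set_mem Sy [<-].
  exact: pw.
- rewrite -w1 [RHS]esum_mkcond; apply: eq_esum => x _.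
  by case: ifP.
Qed.

Lemma word_weight_ge0 (R : realType) o : 0 <= word_weight o :> R.
Proof. by case: o => //= s; rewrite invr_ge0 exprn_ge0. Qed.

(** Since [r n] has total mass 2^-n, [dyadic_layer] applies to [2 ^+ n.+1 * r n], and removing the
    layer found leaves mass 2^-(n+1). The third clause supplies the halving that the allocation
    requires. *)
Lemma dyadic_decomposition (R : realType) (T : countType) (p : T -> R) :
  is_pmf p ->
  exists (k : nat -> T -> option (seq bool)) (r : nat -> T -> R), [/\
    (forall x, r 0%N x = p x) /\
      (forall n x, r n.+1 x = r n x - 2 ^- n.+1 * word_weight (k n x)),
    forall n x, 0 <= r n x <= 2 ^- n,
    forall n x s, k n x = Some s -> r n x <= 2 * (2 ^- n.+1 * 2 ^- size s),
    forall n x y s t, k n x = Some s -> k n y = Some t -> prefix s t -> x = y &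
    forall n, (\esum_(x in [set: T]) (word_weight (k n x) : R)%:E = 1)%E].
Proof.
move=> [p0 p1].
(* The hypotheses sit under the existential, with a dummy layer when they fail, so that [r] can be
   defined by recursion before its invariant is proved. *)
have /choice[K KP] (f : T -> R) : exists k : T -> option (seq bool),
    (forall x, 0 <= f x) -> (\esum_(x in [set: T]) (f x)%:E = 2%:E)%E -> [/\
    forall x s, k x = Some s -> 2 ^- size s <= f x <= 2 * 2 ^- size s,
    forall x y s t, k x = Some s -> k y = Some t -> prefix s t -> x = y &
    (\esum_(x in [set: T]) (word_weight (k x) : R)%:E = 1)%E].
  have [[f0 f2]|nf] := pselect ((forall x, 0 <= f x) /\
      (\esum_(x in [set: T]) (f x)%:E = 2%:E)%E).
    by have [k kP] := dyadic_layer f0 f2; exists k.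
  by exists (fun=> None) => f0 f2; exfalso; apply: nf.
pose layer n (g : T -> R) := K (fun x => 2 ^+ n.+1 * g x).
pose fix r (n : nat) : T -> R := if n is m.+1 then
  fun x => r m x - 2 ^- m.+1 * word_weight (layer m (r m) x) else p.
have pos n : 0 < 2 ^+ n :> R by rewrite exprn_gt0.
have inv n : (forall x, 0 <= r n x) /\
    (\esum_(x in [set: T]) (r n x)%:E = (2 ^- n)%:E)%E ->
    [/\ forall x s, layer n (r n) x = Some s ->
      2 ^- n.+1 * 2 ^- size s <= r n x <= 2 * (2 ^- n.+1 * 2 ^- size s),
    forall x y s t, layer n (r n) x = Some s -> layer n (r n) y = Some t ->
      prefix s t -> x = y &
    (\esum_(x in [set: T]) (word_weight (layer n (r n) x) : R)%:E = 1)%E].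
  move=> [r0 r1]; have [||b pf w1] := KP (fun x => 2 ^+ n.+1 * r n x).
  - by move=> x; rewrite mulr_ge0// ltW.
  - under eq_esum do rewrite EFinM.
    rewrite esumZ ?ltW// r1 -EFinM; congr EFin.
    by rewrite exprS mulfK// gt_eqF.
  - split => // x s /b /andP[h1 h2].
    rewrite mulrC ler_pdivrMr// mulrC [r n x * _]mulrC h1 /=.
    by rewrite mulrCA -ler_pdivrMl// invrK.
have rP n : (forall x, 0 <= r n x) /\
    (\esum_(x in [set: T]) (r n x)%:E = (2 ^- n)%:E)%E.
  elim: n => [|n IH]; first by rewrite expr0 invr1.
  have [b _ w1] := inv _ IH; case: IH => r0 r1.
  have rS0 x : 0 <= r n.+1 x.
    rewrite /= subr_ge0; case E : (layer n (r n) x) => [s|] /=.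
      by have /andP[] := b _ _ E.
    by rewrite mulr0.
  split => //; have := r1.
  rewrite (eq_esum (b := fun x => ((r n.+1 x)%:E +
     (2 ^- n.+1)%:E * (word_weight (layer n (r n) x))%:E)%E)); last first.
    by move=> x _; rewrite -EFinM -EFinD /= subrK.
  rewrite esumD; last 2 first.
  - by move=> x _; rewrite lee_fin.
  - by move=> x _; rewrite -EFinM lee_fin mulr_ge0 ?word_weight_ge0// invr_ge0 ltW.
  rewrite esumZ ?w1 ?mule1; last 2 first.
  - by rewrite invr_ge0 ltW.
  - by move=> x; rewrite lee_fin word_weight_ge0.
  have -> : 2 ^- n = 2 ^- n.+1 + 2 ^- n.+1 :> R.
    by rewrite exprS; field; rewrite expf_neq0.
  case: (esum _ _) => [z| |] //; rewrite -EFinD => -[e]; congr EFin; lra.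
exists (fun n => layer n (r n)), r; split => //.
- move=> n x; have [r0 r1] := rP n; rewrite r0 /= -lee_fin -r1.
  rewrite (_ : r n x = \sum_(y <- [:: x]) r n y); last by rewrite big_seq1.
  by apply: seq_le_esum.
- by move=> n x s; have [b _ _] := inv _ (rP n) => /b /andP[].
- by move=> n; have [_ pf _] := inv _ (rP n).
- by move=> n; have [_ _ w1] := inv _ (rP n).
Qed.

(* [phi x i] is the block announced on source value [x] and local value [i]. *)
Lemma simulated_decomposition (R : realType) (T : countType) (p : T -> R) :
  is_pmf p ->
  exists (k : nat -> T -> option (seq bool)) (phi : T -> nat -> nat), [/\
    forall n x, ((p x)%:E * (\esum_(i in [set i | phi x i = n]) (harmonic_atom i : R)%:E)
      = (2 ^- n.+1 * word_weight (k n x))%:E)%E,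
    forall n x, 2 ^- n.+1 * word_weight (k n x) <= p x,
    forall n x y s t, k n x = Some s -> k n y = Some t -> prefix s t -> x = y &
    forall n, (\esum_(x in [set: T]) (word_weight (k n x) : R)%:E = 1)%E].
Proof.
move=> pmf; have [k [r [[r0 rS] rb rk pf w1]]] := dyadic_decomposition pmf.
have w0 n x : 0 <= 2 ^- n.+1 * word_weight (k n x) :> R.
  by rewrite mulr_ge0 ?word_weight_ge0// invr_ge0 exprn_ge0.
have rdec n x : r n.+1 x <= r n x by rewrite rS gerBl.
have rp n x : r n x <= p x.
  by elim: n => [|n IH]; [rewrite r0|exact: le_trans IH].
have wp n x : 2 ^- n.+1 * word_weight (k n x) <= p x.
  have /andP[h _] := rb n.+1 x; have := rp n x; rewrite rS in h; lra.
exists k, (fun x => bin (fun n => r n x / p x)); split => // n x.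
have [px|] := ltP 0 (p x); last first.
  move=> px; have -> : p x = 0 by apply/le_anti; rewrite px; case: pmf => -> .
  rewrite mul0e; congr EFin; apply/le_anti.
  by rewrite w0 (le_trans (wp n x) px).
(* The allocation is applied to [r n x / p x], which tends to 0 because [r n x <= 2 ^- n]. *)
rewrite bin_mass.
- rewrite -EFinM; congr EFin; rewrite rS; by field; rewrite ?expf_neq0 ?gt_eqF.
- by rewrite r0 divff// gt_eqF.
- by move=> m; rewrite divr_ge0 ?(ltW px)//; have /andP[] := rb m x.
- move=> e e0; have [m hm] := exp2N_le (mulr_gt0 e0 px); exists m.
  by rewrite ler_pdivrMr//; have /andP[_ h] := rb m x; exact: le_trans hm.
- by move=> m; rewrite ler_pM2r ?invr_gt0.
- move=> m h; rewrite mulrA ler_pM2r ?invr_gt0//.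
  rewrite rS; case E : (k m x) => [s|].
    by have := rk _ _ _ E; rewrite /=; lra.
  by move: h; rewrite rS E /= mulr0 subr0 eqxx.
Qed.

(** * The scheme *)

Lemma esum_single (R : realType) (T : choiceType) (a : T -> \bar R) (x0 : T) :
  (0 <= a x0)%E -> (forall x, x != x0 -> a x = 0%E) ->
  (\esum_(x in [set: T]) a x = a x0)%E.
Proof.
move=> a0 an; rewrite -(esum_set1 a0) [RHS]esum_mkcond; apply: eq_esum => x _.
by rewrite in_set1; case: eqP => // /eqP /an.
Qed.

Lemma esum_slices (R : realType) (T1 T2 : choiceType) (A : set (T1 * T2))
    (a : T1 * T2 -> \bar R) : (forall z, 0 <= a z)%E ->
  (\esum_(z in A) a z =
   \esum_(x in [set: T1]) \esum_(y in [set y | A (x, y)]) a (x, y))%E.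
Proof.
move=> a0; rewrite esum_esum//.
rewrite (_ : _ `*`` _ = A); last by apply/seteqP; split => -[x y] //= [].
by apply: eq_esum => -[].
Qed.

Lemma esum_geometric_le2 (R : realType) :
  (\esum_(n in [set: nat]) (n.+1%:R * 2 ^- n.+1 : R)%:E <= 2%:E)%E.
Proof.
apply: esum_le_seq => s us _.
pose B := (\max_(i <- s) i)%N.+1.
have sB : {subset s <= iota 0 B}.
  move=> i si; rewrite mem_iota /= add0n ltnS.
  exact: (@leq_bigmax_seq _ s xpredT id).
have g0 n : 0 <= n.+1%:R * 2 ^- n.+1 :> R.
  by rewrite mulr_ge0// invr_ge0 exprn_ge0.
apply: le_trans (ler_sum_sub_uniq us (iota_uniq 0 B) sB g0) _.
have -> : \sum_(n <- iota 0 B) n.+1%:R * 2 ^- n.+1 = 2 - B.+2%:R * 2 ^- B :> R.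
  elim: B {sB} => [|m IH]; first by rewrite big_nil expr0 invr1 mulr1 subrr.
  rewrite -addn1 iotaD big_cat big_seq1 /= IH add0n addn1 exprS.
  rewrite -[m.+3%:R]natr1 -[m.+2%:R]natr1.
  by field; rewrite expf_neq0.
by rewrite gerBl mulr_ge0// invr_ge0 exprn_ge0.
Qed.

Lemma neg_log2_le (R : realType) (m : nat) (x : R) : 2 ^- m <= x ->
  - log2 x <= m%:R.
Proof.
move=> h; have p0 : 0 < 2 ^- m :> R by rewrite invr_gt0 exprn_gt0.
have ln2 : 0 < ln 2 :> R by rewrite ln_gt0// ltr1n.
rewrite /log2 lerNl ler_pdivlMr//.
have x0 := lt_le_trans p0 h; move: h; rewrite -ler_ln ?posrE//.
by rewrite lnV ?posrE ?exprn_gt0// lnXn// -[_ *+ m]mulr_natl mulNr.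
Qed.

Section Scheme.
Variables (R : realType) (T : countType) (p : T -> R).
Hypothesis p_pmf : is_pmf p.
Variables (k : nat -> T -> option (seq bool)) (phi : T -> nat -> nat).
Hypothesis block_mass : forall n x,
  ((p x)%:E * (\esum_(i in [set i | phi x i = n]) (harmonic_atom i : R)%:E)
   = (2 ^- n.+1 * word_weight (k n x))%:E)%E.
Hypothesis block_le : forall n x, 2 ^- n.+1 * word_weight (k n x) <= p x.
Hypothesis block_prefix : forall n x y s t,
  k n x = Some s -> k n y = Some t -> prefix s t -> x = y.
Hypothesis block_complete : forall n,
  (\esum_(x in [set: T]) (word_weight (k n x) : R)%:E = 1)%E.

Let atom i : R := harmonic_atom i.
Let P (om : T * nat) : R := p om.1 * atom om.2.
Let msg (om : T * nat) := phi om.1 om.2.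
Let key (om : T * nat) := odflt [::] (k (msg om) om.1).

Let p0 x : 0 <= p x. Proof. by case: p_pmf. Qed.
Let a0 i : 0 <= atom i. Proof. exact/ltW/atom_gt0. Qed.
Let P0 om : 0 <= P om. Proof. by rewrite mulr_ge0. Qed.

Lemma scheme_slices (A : set (T * nat)) :
  (\esum_(om in A) (P om)%:E = \esum_(x in [set: T])
    ((p x)%:E * (\esum_(i in [set i | A (x, i)]) (atom i)%:E)))%E.
Proof.
rewrite esum_slices; last by move=> z; rewrite lee_fin.
apply: eq_esum => x _; rewrite -esumZ//.
Qed.

Lemma scheme_pmf : is_pmf P.
Proof.
split=> //; rewrite scheme_slices.
rewrite (eq_esum (b := fun x => (p x)%:E)); first by case: p_pmf.
move=> x _; rewrite (_ : [set i | _] = setT) ?esum_harmonic_atom ?mule1//.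
Qed.

Lemma scheme_PrE A : ((Pr P A)%:E = \esum_(x in [set: T])
    ((p x)%:E * (\esum_(i in [set i | A (x, i)]) (atom i)%:E)))%E.
Proof. by rewrite -scheme_slices (PrK _ P0 scheme_pmf.2). Qed.

Lemma scheme_Pr_source x (Q : set nat) :
  Pr P [set om | om.1 = x /\ Q om.2] = p x * Pr atom Q.
Proof.
apply: EFin_inj; rewrite EFinM (PrK _ a0 (esum_harmonic_atom R)) scheme_PrE.
rewrite (esum_single (x0 := x)).
- by congr (_ * esum _ _)%E; apply/seteqP; split => i /=; tauto.
- by rewrite mule_ge0// ?lee_fin// esum_ge0// => i _; rewrite lee_fin.
- move=> y yx; rewrite (_ : [set i | _] = set0) ?esum_set0 ?mule0//.
  by apply/seteqP; split => i //= -[e]; move: yx; rewrite e eqxx.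
Qed.

(** Summing [block_mass] over the source values leaves 2^-(n+1) times the total weight of the block,
    which is 1. *)
Lemma scheme_Pr_msg n : Pr P [set om | msg om = n] = 2 ^- n.+1.
Proof.
apply: EFin_inj; rewrite scheme_PrE.
rewrite (eq_esum (b := fun x => ((2 ^- n.+1)%:E * (word_weight (k n x))%:E)%E)).
  rewrite esumZ ?block_complete ?mule1// ?invr_ge0 ?exprn_ge0// => x.
  by rewrite lee_fin word_weight_ge0.
by move=> x _; rewrite -EFinM -block_mass.
Qed.

Lemma scheme_Pr_key_msg n s : Pr P [set om | key om = s /\ msg om = n] =
  if `[< exists x, k n x = Some s >] then 2 ^- n.+1 * 2 ^- size s else 0.
Proof.
apply: EFin_inj; rewrite scheme_PrE.
(* A value outside block [n] has the default word [[::]], but its weight is 0, so it adds nothing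
   even if [s] is empty. *)
rewrite (eq_esum (b := fun x => (if odflt [::] (k n x) == s
   then 2 ^- n.+1 * word_weight (k n x) else 0)%:E)); last first.
  move=> x _; case: eqP => [ks|ks].
    rewrite -block_mass; congr (_ * esum _ _)%E.
    apply/seteqP; split => i /=; first by case.
    by rewrite /key /msg /= => e; rewrite e.
  rewrite (_ : [set i | _] = set0) ?esum_set0 ?mule0//.
  by apply/seteqP; split => i //=; rewrite /key /msg /= => -[+ e]; rewrite e.
case: asboolP => [[x0 kx0]|nos].
  rewrite (esum_single (x0 := x0)) ?kx0 /= ?eqxx//.
  move=> x xx0; case E : (k n x) => [t|] /=; last by rewrite mulr0 if_same.
  case: eqP => // ts; move/eqP: xx0; case; rewrite ts in E.
  by apply: block_prefix E kx0 _; rewrite prefix_refl.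
rewrite esum1// => x _; case E : (k n x) => [t|] /=; last by rewrite mulr0 if_same.
by case: eqP => // ts; exfalso; apply: nos; exists x; rewrite E ts.
Qed.

(** Dividing the joint law by 2^-(n+1) leaves [2 ^- size s] on the words of block [n] and 0
    elsewhere: the leaf distribution of a complete prefix code. *)
Lemma scheme_randomly_stopped : cond_randomly_stopped P msg key.
Proof.
move=> n _; pose C := [set s | exists x, k n x = Some s].
have n0 : 2 ^- n.+1 != 0 :> R by rewrite invr_eq0 expf_neq0.
apply: (@prefix_code_randomly_stopped R C).
- move=> s t [x kx] [y ky] st; have xy := block_prefix kx ky st.
  by move: ky; rewrite -xy kx => -[].
- rewrite -(block_complete n).
  have -> : C = (fun x => odflt [::] (k n x)) @` [set x | k n x != None].
    apply/seteqP; split => s /= => [[x kx]|[x]].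
      by exists x; rewrite kx.
    by case E : (k n x) => [t|] //= _ <-; exists x.
  rewrite esum_image; last first.
    move=> x y /set_mem /=; case E : (k n x) => [s|] //= _ /set_mem /=.
    case F : (k n y) => [t|] //= _ st; apply: block_prefix E F _.
    by rewrite st prefix_refl.
  rewrite esum_mkcond; apply: eq_esum => x _.
  case: ifPn => [/set_mem /=|/negP h]; first by case: (k n x).
  case E : (k n x) => [s|] //=; exfalso; apply: h.
  by apply/mem_set => /=; rewrite E.
- move=> s Cs; rewrite scheme_Pr_msg scheme_Pr_key_msg asboolT//.
  by rewrite mulrAC divff// mul1r.
- by move=> s Cs; rewrite scheme_Pr_key_msg asboolF// mul0r.
Qed.

Lemma scheme_length om : 0 < P om ->
  - log2 (p om.1) <= (size (key om))%:R + (msg om).+1%:R.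
Proof.
case: om => x i; rewrite /P /= => Ppos.
have px : 0 < p x.
  by rewrite lt_def p0 andbT; apply: contraTneq Ppos => ->; rewrite mul0r ltxx.
(* Positive block mass excludes [None], so the key is a true codeword and not the default. *)
have : 0 < 2 ^- (phi x i).+1 * word_weight (k (phi x i) x) :> R.
  rewrite -lte_fin -block_mass mule_gt0 ?lte_fin//.
  apply: (@lt_le_trans _ _ (\sum_(j <- [:: i]) atom j)%:E).
    by rewrite big_seq1 lte_fin atom_gt0.
  by apply: seq_le_esum => // j; rewrite inE => /eqP ->.
have := block_le (phi x i) x; rewrite /key /msg /=.
case: (k _ _) => [s|] /=; last by rewrite mulr0 ltxx.
by move=> h _; rewrite -natrD; apply: neg_log2_le; rewrite addnC exprD invfM.
Qed.

Lemma scheme_msg_expectation :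
  (\esum_(om in [set: T * nat]) ((msg om).+1%:R * P om)%:E <= 2%:E)%E.
Proof.
have -> : [set: T * nat] = \bigcup_(n in [set: nat]) [set om | msg om = n].
  by apply/seteqP; split => om // _; exists (msg om).
rewrite esum_bigcupT; last 2 first.
- by move=> m n _ _ [om [/= <- <-]].
- by move=> om; rewrite lee_fin mulr_ge0.
apply: le_trans (esum_geometric_le2 R); apply: le_esum => n _.
rewrite -(scheme_Pr_msg n) EFinM (PrK _ P0 scheme_pmf.2) -esumZ//.
  by apply: le_esum => om /= <-; rewrite -EFinM.
Qed.

(** This is [scheme_length] integrated against [P], in additive form so that an infinite entropy
    needs no separate case. *)
Lemma scheme_entropy :
  (entropy p <= \esum_(om in [set: T * nat]) ((size (key om))%:R * P om)%:E + 2%:E)%E.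
Proof.
have p1 x : p x <= 1.
  rewrite -lee_fin -(p_pmf.2) (_ : p x = \sum_(y <- [:: x]) p y); last by rewrite big_seq1.
  exact: seq_le_esum.
have h0 x : 0 <= - log2 (p x).
  rewrite oppr_ge0 /log2 mulr_le0_ge0 ?invr_ge0//; first by rewrite ln_le0.
  by rewrite ln_ge0// ler1n.
have -> : (entropy p = \esum_(om in [set: T * nat]) (- log2 (p om.1) * P om)%:E)%E.
  rewrite /entropy esum_slices; last by move=> om; rewrite lee_fin mulr_ge0.
  apply: eq_esum => x _.
  rewrite (eq_esum (b := fun i => ((- log2 (p x) * p x)%:E * (atom i)%:E)%E)); last first.
    by move=> i _; rewrite -EFinM /P /= mulrA.
  rewrite esumZ//; last by rewrite mulr_ge0.
  rewrite (_ : [set i | _] = setT)// esum_harmonic_atom mule1 mulNr mulrC//.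
apply: (@le_trans _ _ (\esum_(om in [set: T * nat]) ((size (key om))%:R * P om)%:E +
  \esum_(om in [set: T * nat]) ((msg om).+1%:R * P om)%:E)%E); last first.
  by rewrite leeD2l// scheme_msg_expectation.
rewrite -esumD; last 2 first.
- by move=> om _; rewrite lee_fin mulr_ge0.
- by move=> om _; rewrite lee_fin mulr_ge0.
apply: le_esum => om _; rewrite -EFinD lee_fin -mulrDl.
have [Ppos|] := ltP 0 (P om); first by rewrite ler_wpM2r// scheme_length.
move=> PN; have -> : P om = 0 by apply/le_anti; rewrite PN P0.
by rewrite !mulr0.
Qed.

End Scheme.

Theorem theorem1 (R : realType) (T : countType) (pX : T -> R) :
  is_pmf pX ->
  one_way_achieves (diag_pmf pX) 0 (entropy pX - 2%:E)%E.
Proof.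
move=> pmf; have [k [phi [mass le pf w1]]] := simulated_decomposition pmf.
have a0 i : 0 <= harmonic_atom i :> R by exact/ltW/atom_gt0.
pose P (om : T * nat) : R := pX om.1 * harmonic_atom om.2.
(* An outcome is a source value with Alice's variable G; Bob's randomness is trivial. Both parties
   and [K] read the word of the common source value in the announced block, so they always agree. *)
exists (T * nat)%type, P, nat, unit, nat, (fun om => (om.1, om.1)), snd, (fun=> tt),
  phi, (fun x _ w => odflt [::] (k w x)), (fun x _ w => odflt [::] (k w x)),
  (fun om => odflt [::] (k (phi om.1 om.2) om.1)) => /=.
have Ppmf : is_pmf P := scheme_pmf pmf.
have PT : Pr P setT = 1 by rewrite /Pr Ppmf.2.
(* The set [Q] serves twice: [setT] gives the law of the source, a singleton its independence from
   G. *)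
have Psrc xy (Q : set nat) : Pr P [set om | (om.1, om.1) = xy /\ Q om.2] =
    diag_pmf pX xy * Pr harmonic_atom Q.
  case: xy => x y; rewrite /diag_pmf /=; case: eqP => [<-|xy].
    rewrite -scheme_Pr_source//; congr Pr; apply/seteqP.
    by split => -[z i] /= => [[[-> _] ?]|[-> ?]].
  rewrite mul0r (_ : [set om | _] = set0) ?/Pr ?esum_set0//.
  by apply/seteqP; split => -[z i] //= [[zx zy] _]; apply: xy; rewrite -zx.
have Psrc1 xy : Pr P [set om | (om.1, om.1) = xy] = diag_pmf pX xy.
  rewrite -[RHS]mulr1 -(_ : Pr harmonic_atom setT = 1 :> R).
    by rewrite -Psrc; congr Pr; apply/seteqP; split => om //= [].
  by rewrite /Pr esum_harmonic_atom.
split => //; split => //; split; last split; last split.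
- move=> xy i b; rewrite Psrc1.
  rewrite (_ : [set om | _ = b] = setT); last by apply/seteqP; split => // om _; case: b.
  rewrite PT mulr1 (_ : [set om | _] =
    [set om | (om.1, om.1) = xy /\ [set i] om.2]); last first.
    by apply/seteqP; split => om /= => [[-> [-> _]]|[-> ->]]//; case: b.
  rewrite Psrc; congr (_ * _); apply: EFin_inj; rewrite scheme_PrE//.
  rewrite (eq_esum (b := fun x => ((harmonic_atom i)%:E * (pX x)%:E)%E)).
    by rewrite esumZ ?pmf.2 ?mule1 /Pr ?esum_set1 ?lee_fin//; case: pmf.
  by move=> x _; rewrite muleC esum_set1 ?lee_fin.
- exact: scheme_randomly_stopped.
- by rewrite subr0 (_ : [set om | _] = setT) ?PT//; apply/seteqP; split => om //= _; rewrite !eqxx.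
- rewrite EFinN leeBlDr//; apply: le_trans (scheme_entropy pmf mass le w1) _.
  by rewrite leeD2r//; apply: le_esum => om _; rewrite !eqxx mulr1.
Qed.
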